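(* The shift action of $\mathrm{Diff}([0,1])$ on $\mathcal{H}^+([0,1])$, given by $g \cdot h = g \circ h$, is turbulent.
   Context: $\mathcal{H}^+([0,1])$ is the Polish group of increasing homeomorphisms of $[0,1]$ onto itself, with the supremum metric. $\mathrm{Diff}([0,1]) = \{f \in \mathcal{H}^+([0,1]) : f' \in \mathcal{C}([0,1]),\ (f^{-1})' \in \mathcal{C}([0,1])\}$ (one-sided derivatives at the endpoints), considered as a Polish group with the topology of the metric $d_{\mathrm{Diff}}(f,g) = \sup_{t\in[0,1]}|f(t)-g(t)| + \sup_{t\in[0,1]}|f'(t)-g'(t)|$. Let a Polish group $G$ act continuously on a Polish space $X$. For $x \in X$, $U \subset X$ open with $x\in U$, and $V \subset G$ open with $1_G \in V$, the local $U$-$V$-orbit $\mathcal{O}(x,U,V)$ is the set of $y \in U$ for which there exist $l \in \mathbb{N}$, points $x = x_1, x_2, \dots, x_l = y$ in $U$ and $g_1,\dots,g_{l-1}\in V$ such that $x_{i+1} = g_i \cdot x_i$ for $i<l$. The action is turbulent if (T1) every orbit is meager, (T2) every orbit is dense, and (T3) every local orbit is somewhere dense, i.e. for all open $U\subset X$, $x \in U$, and open $V \subset G$ with $1_G\in V$, the set $\mathcal{O}(x,U,V)$ is somewhere dense. *)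

(* Defs.v *)
From HB Require Import structures.
From mathcomp Require Import all_boot all_order all_algebra.
From mathcomp Require Import all_classical all_reals all_analysis.

Set Implicit Arguments.
Unset Strict Implicit.
Unset Printing Implicit Defensive.

Import Order.TTheory GRing.Theory Num.Theory.
Import numFieldNormedType.Exports.
Local Open Scope classical_set_scope.
Local Open Scope ring_scope.

HB.mixin Record isTopologicalGroup G & Group G & Topological G := {
  mulg_continuous : continuous (fun p : G * G => (p.1 * p.2)%g) ;
  invg_continuous : continuous (fun x : G => (x^-1)%g)
}.

#[short(type="topologicalGroupType")]
HB.structure Definition TopologicalGroup :=
  {G of Group G & Topological G & isTopologicalGroup G}.

(* The Polishness of G and X plays no role in the notions defined below. *)
Record continuous_action (G : topologicalGroupType) (X : topologicalType) := {
  act :> G -> X -> X ;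
  act1 : forall x, act 1%g x = x ;
  actM : forall g h x, act (g * h)%g x = act g (act h x) ;
  act_continuous : continuous (fun p : G * X => act p.1 p.2)
}.

Section Turbulence.
Context {X : topologicalType}.

Definition nowhere_dense (A : set X) : Prop := (closure A)° = set0.

Definition somewhere_dense (A : set X) : Prop := (closure A)° !=set0.

Definition meager (A : set X) : Prop :=
  exists F : nat -> set X,
    (forall n, nowhere_dense (F n)) /\ A = \bigcup_n F n.

Context {G : topologicalGroupType} (a : continuous_action G X).

Definition orbit (x : X) : set X := [set a g x | g in setT].

(* the points are p 0, ..., p n, so [n] is l - 1 in the usual notation *)
Definition local_orbit (x : X) (U : set X) (V : set G) : set X :=
  [set y | U y /\ exists (n : nat) (p : nat -> X) (g : nat -> G),
    [/\ p 0%N = x, p n = y,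
        forall i, (i <= n)%N -> U (p i),
        forall i, (i < n)%N -> V (g i) &
        forall i, (i < n)%N -> p i.+1 = a (g i) (p i)]].

Definition turbulent : Prop :=
  [/\ forall x : X, meager (orbit x),
      forall x : X, dense (orbit x) &
      forall (U : set X) (x : X) (V : set G),
        open U -> U x -> open V -> V 1%g ->
        somewhere_dense (local_orbit x U V)].

End Turbulence.

(* carries the topology induced by R *)
Notation unit_itv R := (set_type (`[0, 1]%classic : set R)).

Section UnitInterval.
Context {R : realType}.
Local Notation I := (unit_itv R).
Implicit Types (f g h : I -> R) (x y t : I).

(* Since the limit is taken in [0, 1], it is one-sided at the endpoints. *)
Definition diff_quot f x : I -> R :=
  fun y => (f y - f x) / (set_val y - set_val x).

Definition derivI f : I -> R := fun x => lim (diff_quot f x y @[y --> x^']).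

Definition C1 f : Prop :=
  (forall x, cvg (diff_quot f x y @[y --> x^'])) /\ continuous (derivI f).

Definition sup_dist f g : R := sup [set `|f t - g t| | t in [set: I]].

Definition incr_homeo (f : I -> I) : Prop :=
  [/\ {homo f : x y / set_val x < set_val y}, continuous f &
      exists g : I -> I, [/\ cancel f g, cancel g f & continuous g]].

Lemma set_val_cts : continuous (set_val : I -> R).
Proof. exact: initial_continuous. Qed.

Lemma cts_set_val (T : topologicalType) (f : T -> I) :
  continuous (set_val \o f) -> continuous f.
Proof. by move=> cf; apply: continuous_comp_initial. Qed.

End UnitInterval.

Section ContinuousFunctions.
Context {R : realType} {T : topologicalType}.

Lemma continuous_mulr (u v : T -> R) :
  continuous u -> continuous v -> continuous (fun x => u x * v x).
Proof. by move=> cu cv x; exact: cvgM (cu x) (cv x). Qed.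

Lemma continuous_comp_all (U V : topologicalType) (u : T -> U) (v : U -> V) :
  continuous u -> continuous v -> continuous (fun x => v (u x)).
Proof. by move=> cu cv x; exact: (continuous_comp (cu x) (cv (u x))). Qed.

End ContinuousFunctions.

Section UnitIntervalTheory.
Context {R : realType}.
Local Notation I := (unit_itv R).
Implicit Types (f g h : I -> R) (x y t : I).

Lemma set_val_inj : injective (set_val : I -> R).
Proof. exact: val_inj. Qed.

Let mkI_subproof (r : R) : 0 <= r <= 1 -> r \in (`[0, 1]%classic : set R).
Proof. by rewrite inE /= in_itv. Qed.

Definition mkI (r : R) (r01 : 0 <= r <= 1) : I :=
  exist (fun r => r \in (`[0, 1]%classic : set R)) r (mkI_subproof r01).

Lemma mkIE (r : R) (r01 : 0 <= r <= 1) : set_val (mkI r01) = r.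
Proof. by []. Qed.

Lemma set_val01 x : 0 <= set_val x <= 1.
Proof. by have := set_valP x; rewrite /= in_itv. Qed.

Lemma nbhsI x (A : set I) : nbhs x A <->
  exists2 e : R, 0 < e & forall y, `|set_val x - set_val y| < e -> A y.
Proof.
split=> [/nbhs_ballP[e e0 eA]|[e e0 eA]]; first by exists e.
by apply/nbhs_ballP; exists e.
Qed.

Lemma ctsIP (T : topologicalType) (f : T -> I) :
  continuous f <-> continuous (set_val \o f).
Proof.
split=> [cf x|cf]; last exact: cts_set_val.
by apply: continuous_comp; [exact: cf|exact: set_val_cts].
Qed.

Lemma compactI : compact [set: I].
Proof.
pose c (r : R) : R := Num.max 0 (Num.min 1 r).
have cP r : c r \in (`[0, 1]%classic : set R).
  by rewrite inE /= in_itv /= /c le_max lexx ge_max ler01 ge_min lexx.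
pose C (r : R) : I := exist _ (c r) (cP r).
have cC : continuous C.
  apply: cts_set_val => r; apply: continuous_max; first exact: cvg_cst.
  by apply: continuous_min; [exact: cvg_cst|exact: cvg_id].
have -> : [set: I] = C @` `[0, 1]%classic.
  apply/seteqP; split=> // x _; have := set_valP x => /= x01.
  exists (set_val x) => //; apply: set_val_inj; rewrite /= {1}/set_val /=.
  move: x01; rewrite in_itv /= => /andP[x0 x1].
  by rewrite /c (min_idPr x1) (max_idPr x0).
apply: continuous_compact; last exact: segment_compact.
exact: continuous_subspaceT.
Qed.

Lemma unif_ctsI f : continuous f -> forall e : R, 0 < e ->
  exists2 d : R, 0 < d &
    forall x y, `|set_val x - set_val y| < d -> `|f x - f y| < e.
Proof.
move=> cf e e0.
have := compact_near_coveringP [set: I].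
move=> -[/(_ compactI) K _].
have /= := K _ (0^'+ : set_system R)
  (fun d x => forall y, `|set_val x - set_val y| < d -> `|f x - f y| < e) _ _.
case=> [x _|d /= d0 H]; last first.
  exists (d / 2); first by rewrite divr_gt0.
  move=> x y xy; apply: (H (d / 2)) => //=; last by rewrite divr_gt0.
  by rewrite sub0r normrN gtr0_norm ?divr_gt0// gtr_pMr// invf_lt1// ltr1n.
have e2 : 0 < e / 2 by rewrite divr_gt0.
have /cvgrPdist_lt/(_ _ e2) /nbhsI[d d0 H] := cf x.
exists ([set y | `|set_val x - set_val y| < d / 2], [set r | r < d / 2]).
  split=> /=; first by apply/nbhsI; exists (d / 2) => //; rewrite divr_gt0.
  exact/nbhs_right_lt/divr_gt0.
move=> [y r] [/= xy rd] z yz.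
rewrite (splitr e) -(subrKA (f x)) (le_lt_trans (ler_normD _ _))//.
rewrite ltrD//; last first.
  apply: H; rewrite (splitr d) -(subrKA (set_val y)).
  by rewrite (le_lt_trans (ler_normD _ _))// ltrD// (lt_trans yz).
rewrite distrC; apply: H.
by rewrite (lt_trans xy)// gtr_pMr// invf_lt1// ltr1n.
Qed.

Lemma boundedI f : continuous f -> exists2 M : R, 0 < M & forall x, `|f x| <= M.
Proof.
move=> cf; have /compact_bounded[M [_ H]] : compact (f @` [set: I]).
  by apply: continuous_compact compactI; exact: continuous_subspaceT.
exists (`|M| + 1); first by rewrite ltr_wpDl.
move=> x; apply: (H (`|M| + 1)); last by exists x.
by rewrite (le_lt_trans (ler_norm _))// ltrDl.
Qed.

Lemma sup_dist_ge f g t : continuous f -> continuous g ->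
  `|f t - g t| <= sup_dist f g.
Proof.
move=> cf cg; have [M _ HM] := boundedI cf; have [N _ HN] := boundedI cg.
apply: ub_le_sup; last by exists t.
exists (M + N) => _ [s _ <-].
by rewrite (le_trans (ler_normB _ _))// lerD.
Qed.

Let zeroI : I := @mkI 0 (introT andP (conj (lexx 0) ler01)).

Lemma sup_dist_le f g (e : R) :
  (forall t, `|f t - g t| <= e) -> sup_dist f g <= e.
Proof.
move=> H; apply: ge_sup; first by exists `|f zeroI - g zeroI|; exists zeroI.
by move=> _ [t _ <-].
Qed.

Lemma sup_dist_ge0 f g : continuous f -> continuous g -> 0 <= sup_dist f g.
Proof. by move=> cf cg; rewrite (le_trans _ (sup_dist_ge zeroI cf cg)). Qed.

Lemma sup_distxx f : sup_dist f f = 0.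
Proof.
rewrite /sup_dist (_ : [set _ | _ in _] = [set 0]) ?sup1//.
apply/seteqP; split=> [_ [t _ <-]|_ ->]; first by rewrite subrr normr0.
by exists zeroI => //; rewrite subrr normr0.
Qed.

Lemma sup_distC f g : sup_dist f g = sup_dist g f.
Proof. by congr sup; apply: eq_imagel => t _; rewrite distrC. Qed.

Lemma sup_dist0 f g : continuous f -> continuous g ->
  sup_dist f g = 0 -> f =1 g.
Proof.
move=> cf cg fg t; apply/eqP; rewrite -subr_eq0 -normr_le0 -fg.
exact: sup_dist_ge.
Qed.

Lemma sup_dist_triangle f g h : continuous f -> continuous g -> continuous h ->
  sup_dist f h <= sup_dist f g + sup_dist g h.
Proof.
move=> cf cg ch; apply: sup_dist_le => t.
rewrite -(subrKA (g t)) (le_trans (ler_normD _ _))//.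
by rewrite lerD//; exact: sup_dist_ge.
Qed.

Global Instance dnbhsI_proper x : ProperFilter x^'.
Proof.
apply: Build_ProperFilter_ex => A /nbhsI[e e0 eA].
have /andP[x0 x1] := set_val01 x.
have [y [yx yd]] : exists y : I, y != x /\ `|set_val x - set_val y| < e.
  pose d := Num.min (e / 2) (1 / 2).
  have d0 : 0 < d by rewrite lt_min !divr_gt0.
  have de : d < e by rewrite gt_min gtr_pMr// invf_lt1// ltr1n.
  have d2 : d <= 1 / 2 by rewrite ge_min lexx orbT.
  have [xh|xh] := leP (set_val x) (1 / 2).
    have yP : 0 <= set_val x + d <= 1.
      rewrite addr_ge0 ?(ltW d0)//=.
      by rewrite (le_trans (lerD xh d2))// -splitr.
    exists (mkI yP); split.
      apply/eqP => /(congr1 set_val)/eqP; rewrite mkIE.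
      by rewrite -subr_eq0 addrAC subrr add0r (gt_eqF d0).
    by rewrite mkIE opprD addrA subrr add0r normrN gtr0_norm.
  have yP : 0 <= set_val x - d <= 1.
    rewrite subr_ge0 (le_trans d2 (ltW xh))/=.
    by rewrite (le_trans _ x1)// gerBl (ltW d0).
  exists (mkI yP); split.
    apply/eqP => /(congr1 set_val)/eqP; rewrite mkIE.
    by rewrite -subr_eq0 addrAC subrr add0r oppr_eq0 (gt_eqF d0).
  by rewrite mkIE opprB addrCA subrr addr0 gtr0_norm.
by exists y; apply: (eA y yd).
Qed.

Lemma derivI_cvg f x : cvg (diff_quot f x y @[y --> x^']) ->
  diff_quot f x y @[y --> x^'] --> derivI f x.
Proof. by []. Qed.

Lemma derivI_eq f x (l : R) :
  diff_quot f x y @[y --> x^'] --> l -> derivI f x = l.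
Proof. by move=> fl; apply/cvg_lim. Qed.

Lemma C1_witness f df : continuous df ->
  (forall x, diff_quot f x y @[y --> x^'] --> df x) ->
  C1 f /\ derivI f = df.
Proof.
move=> cdf H; have E : derivI f = df.
  by apply/funext => x; exact: derivI_eq.
split=> //; split; last by rewrite E.
by move=> x; apply/cvg_ex; exists (df x).
Qed.

Lemma derivI_id : C1 (set_val : I -> R) /\ derivI (set_val : I -> R) = cst 1.
Proof.
apply: C1_witness => [|x]; first exact: cst_continuous.
apply: (cvg_trans _ (@cvg_cst _ (1 : R) _ x^' _)).
apply: near_eq_cvg; apply/nbhsI; exists 1 => // y _ yx.
rewrite /diff_quot divff// subr_eq0.
by apply: contra_neq yx => /set_val_inj.
Qed.

Lemma derivI_comp f (k : I -> I) : C1 f -> C1 (set_val \o k) ->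
  injective k -> continuous k ->
  C1 (f \o k) /\
  derivI (f \o k) = (fun x => derivI f (k x) * derivI (set_val \o k) x).
Proof.
move=> [f1 f2] [k1 k2] ki kc; apply: C1_witness => [|x].
  exact: (continuous_mulr (continuous_comp_all kc f2) k2).
have H1 : diff_quot f (k x) (k y) @[y --> x^'] --> derivI f (k x).
  apply: (cvg_comp _ _ _ (f1 (k x))).
  move=> A /= kA; have := kc x _ kA; rewrite /= /nbhs /= => H.
  rewrite /dnbhs /within /= in H *.
  by apply: (@filterS _ _ (nbhs_filter x) _ _ _ H) => y Hy yx; apply: Hy; apply: contra_neq yx => /ki.
apply: (cvg_trans _ (@cvgM _ _ _ (dnbhs_filter x) _ _ _ _ H1 (k1 x))).
apply: near_eq_cvg; apply/nbhsI; exists 1 => // y _ yx.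
rewrite /diff_quot /= mulrA; congr (_ / _).
rewrite -mulrA mulVf ?mulr1// subr_eq0.
by apply: contra_neq yx => /set_val_inj/ki.
Qed.

End UnitIntervalTheory.

Section HplusDef.
Variable R : realType.
Local Notation I := (unit_itv R).

Record Hplus := MkHplus {
  Hplus_fun :> I -> I ;
  Hplus_prop : `[< incr_homeo Hplus_fun >] }.

HB.instance Definition _ := [isSub for Hplus_fun].
HB.instance Definition _ := [Choice of Hplus by <:].

Lemma HplusP (f : Hplus) : incr_homeo f.
Proof. exact/asboolP/Hplus_prop. Qed.

Lemma Hplus_continuous (f : Hplus) : continuous f.
Proof. by case: (HplusP f). Qed.

Lemma Hplus_val_continuous (f : Hplus) : continuous (set_val \o f).
Proof. exact/ctsIP/Hplus_continuous. Qed.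

Lemma HplusE (f g : Hplus) : f =1 g -> f = g.
Proof. by move=> fg; apply/val_inj/funext. Qed.

Definition mk_Hplus (f : I -> I) (fP : incr_homeo f) : Hplus :=
  MkHplus (introT (asboolP _) fP).

Lemma id_incr_homeo : incr_homeo (@id I).
Proof.
have ci : continuous (@id I) by move=> x A.
by split=> //; exists (@id I); split.
Qed.

Lemma comp_incr_homeo (f g : Hplus) : incr_homeo (f \o g).
Proof.
have [f1 f2 [f' [f3 f4 f5]]] := HplusP f.
have [g1 g2 [g' [g3 g4 g5]]] := HplusP g.
split; first by move=> x y xy; apply: f1; apply: g1.
  exact: continuous_comp_all.
exists (g' \o f'); split; [exact: can_comp|exact: can_comp|].
exact: continuous_comp_all.
Qed.

Definition Hplus_inv_fun (f : Hplus) : I -> I :=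
  let: And3 _ _ fe := HplusP f in projT1 (cid fe).

Lemma Hplus_inv_funP (f : Hplus) :
  [/\ cancel f (Hplus_inv_fun f), cancel (Hplus_inv_fun f) f &
      continuous (Hplus_inv_fun f)].
Proof.
by rewrite /Hplus_inv_fun; case: (HplusP f) => _ _ fe; case: (cid fe).
Qed.

Lemma inv_incr_homeo (f : Hplus) : incr_homeo (Hplus_inv_fun f).
Proof.
have [f1 f2 _] := HplusP f; have [f3 f4 f5] := Hplus_inv_funP f.
split=> //; last by exists f.
move=> x y xy; rewrite ltNge; apply/negP.
rewrite le_eqVlt => /predU1P[/set_val_inj/(can_inj f4) yx|/f1].
  by move: xy; rewrite yx ltxx.
by rewrite !f4 => /lt_trans/(_ xy); rewrite ltxx.
Qed.

Definition Hplus_one : Hplus := mk_Hplus id_incr_homeo.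
Definition Hplus_mul (f g : Hplus) : Hplus := mk_Hplus (comp_incr_homeo f g).
Definition Hplus_inv (f : Hplus) : Hplus := mk_Hplus (inv_incr_homeo f).

Fact Hplus_mulA : associative Hplus_mul.
Proof. by move=> f g h; exact: HplusE. Qed.
Fact Hplus_mul1 : left_id Hplus_one Hplus_mul.
Proof. by move=> f; exact: HplusE. Qed.
Fact Hplus_1mul : right_id Hplus_one Hplus_mul.
Proof. by move=> f; exact: HplusE. Qed.
Fact Hplus_mulV : left_inverse Hplus_one Hplus_inv Hplus_mul.
Proof. by move=> f; have [f3 _ _] := Hplus_inv_funP f; exact: HplusE. Qed.
Fact Hplus_Vmul : right_inverse Hplus_one Hplus_inv Hplus_mul.
Proof. by move=> f; have [_ f4 _] := Hplus_inv_funP f; exact: HplusE. Qed.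

(* multiplication is composition: (f * g) x = f (g x) *)
HB.instance Definition _ := isGroup.Build Hplus
  Hplus_mulA Hplus_mul1 Hplus_1mul Hplus_mulV Hplus_Vmul.

Lemma Hplus_1E : (1%g : Hplus) = id :> (I -> I).
Proof. by []. Qed.
Lemma Hplus_mulE (f g : Hplus) : (f * g)%g = f \o g :> (I -> I).
Proof. by []. Qed.
Lemma Hplus_invK (f : Hplus) : cancel f (f^-1)%g.
Proof. by case: (Hplus_inv_funP f). Qed.
Lemma Hplus_invVK (f : Hplus) : cancel (f^-1)%g f.
Proof. by case: (Hplus_inv_funP f). Qed.

Definition Hplus_dist (f g : Hplus) : R :=
  sup_dist (set_val \o f) (set_val \o g).

Fact Hplus_distxx f : Hplus_dist f f = 0.
Proof. exact: sup_distxx. Qed.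
Fact Hplus_dist0 f g : Hplus_dist f g = 0 -> f = g.
Proof.
move=> /sup_dist0 fg; apply: HplusE => t; apply: set_val_inj.
by apply: fg; exact: Hplus_val_continuous.
Qed.
Fact Hplus_distC f g : Hplus_dist f g = Hplus_dist g f.
Proof. exact: sup_distC. Qed.
Fact Hplus_dist_triangle g f h :
  Hplus_dist f h <= Hplus_dist f g + Hplus_dist g h.
Proof. by apply: sup_dist_triangle; exact: Hplus_val_continuous. Qed.

HB.instance Definition _ := isMetric.Build R Hplus
  Hplus_distxx Hplus_dist0 Hplus_distC Hplus_dist_triangle.

Definition diffeo (f : Hplus) : Prop :=
  C1 (set_val \o f) /\ C1 (set_val \o (f^-1)%g).

Definition diff_pred : {pred Hplus} := fun f => `[< diffeo f >].

Record Diff := MkDiff { Diff_homeo :> Hplus ; Diff_prop : diff_pred Diff_homeo }.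

HB.instance Definition _ := [isSub for Diff_homeo].
HB.instance Definition _ := [Choice of Diff by <:].

Lemma C1_mul (f g : Hplus) : C1 (set_val \o f) -> C1 (set_val \o g) ->
  C1 (set_val \o (f * g)%g).
Proof.
move=> Cf Cg; case: (derivI_comp Cf Cg) => //; last exact: Hplus_continuous.
exact: can_inj (Hplus_invK g).
Qed.

Fact diff_group_closed : group_closed diff_pred.
Proof.
split=> [|f g /asboolP[f1 f2] /asboolP[g1 g2]]; apply/asboolP; split.
- by have [] := @derivI_id R.
- by rewrite invg1; have [] := @derivI_id R.
- exact: C1_mul.
- by rewrite invgM invgK; exact: C1_mul.
Qed.

HB.instance Definition _ := SubChoice_isSubGroup.Build Hplus diff_pred Diff
  diff_group_closed.

Definition Diff_deriv (f : Diff) : I -> R := derivI (set_val \o f).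

Lemma DiffP (f : Diff) : diffeo f.
Proof. exact/asboolP/Diff_prop. Qed.

Lemma Diff_deriv_continuous (f : Diff) : continuous (Diff_deriv f).
Proof. by have [[]] := DiffP f. Qed.

Definition Diff_dist (f g : Diff) : R :=
  sup_dist (set_val \o f) (set_val \o g) +
  sup_dist (Diff_deriv f) (Diff_deriv g).

Fact Diff_distxx f : Diff_dist f f = 0.
Proof. by rewrite /Diff_dist !sup_distxx addr0. Qed.
Fact Diff_dist0 f g : Diff_dist f g = 0 -> f = g.
Proof.
move/eqP; rewrite paddr_eq0; first by move=> /andP[/eqP/Hplus_dist0/val_inj].
  by apply: sup_dist_ge0; exact: Hplus_val_continuous.
by apply: sup_dist_ge0; exact: Diff_deriv_continuous.
Qed.
Fact Diff_distC f g : Diff_dist f g = Diff_dist g f.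
Proof. by rewrite /Diff_dist sup_distC [X in _ + X]sup_distC. Qed.
Fact Diff_dist_triangle g f h : Diff_dist f h <= Diff_dist f g + Diff_dist g h.
Proof.
rewrite /Diff_dist addrACA lerD//; first exact: Hplus_dist_triangle.
by apply: sup_dist_triangle; exact: Diff_deriv_continuous.
Qed.

HB.instance Definition _ := isMetric.Build R Diff
  Diff_distxx Diff_dist0 Diff_distC Diff_dist_triangle.

End HplusDef.

Section UniformConvergence.
Context {R : realType} {T : Type} (F : set_system T) {FF : Filter F}.
Local Notation I := (unit_itv R).

Definition ucvg (u : T -> I -> R) (u0 : I -> R) : Prop :=
  forall e : R, 0 < e -> \forall z \near F, forall t, `|u0 t - u z t| < e.

Lemma ucvgM (u v : T -> I -> R) (u0 v0 : I -> R) : continuous u0 -> continuous v0 ->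
  ucvg u u0 -> ucvg v v0 ->
  ucvg (fun z t => u z t * v z t) (fun t => u0 t * v0 t).
Proof.
move=> cu0 cv0 uu0 vv0 e e0.
have [M M0 HM] := boundedI cu0; have [N N0 HN] := boundedI cv0.
have N1 : 0 < N + 1 by rewrite addr_gt0.
near=> z => t.
have uz : `|u0 t - u z t| < e / 2 / (N + 1).
  by move: t; near: z; apply: uu0; rewrite !divr_gt0.
have vz : `|v0 t - v z t| < e / 2 / M.
  by move: t {uz}; near: z; apply: vv0; rewrite !divr_gt0.
have v1 : `|v0 t - v z t| < 1.
  by move: t {uz vz}; near: z; exact: vv0.
have vN : `|v z t| <= N + 1.
  rewrite -[v z t](subrK (v0 t)) addrC (le_trans (ler_normD _ _))//.
  by rewrite lerD// distrC ltW.
have -> : u0 t * v0 t - u z t * v z t =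
    u0 t * (v0 t - v z t) + (u0 t - u z t) * v z t.
  by rewrite mulrBr mulrBl addrA subrK.
rewrite (le_lt_trans (ler_normD _ _))// (splitr e) ltr_leD// !normrM.
  rewrite (@le_lt_trans _ _ (M * `|v0 t - v z t|))//.
    by rewrite ler_wpM2r.
  by rewrite mulrC -ltr_pdivlMr.
rewrite (@le_trans _ _ (`|u0 t - u z t| * (N + 1)))//.
  by rewrite ler_wpM2l.
by rewrite -ler_pdivlMr// ltW.
Unshelve. all: by end_near. Qed.

Lemma ucvg_comp (u : T -> I -> R) (u0 : I -> R) (w : T -> I -> I)
    (w0 : I -> I) : continuous u0 -> ucvg u u0 ->
  ucvg (fun z => set_val \o w z) (set_val \o w0) ->
  ucvg (fun z => u z \o w z) (u0 \o w0).
Proof.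
move=> cu0 uu0 ww0 e e0.
have e2 : 0 < e / 2 by rewrite divr_gt0.
have [d d0 Hd] := unif_ctsI cu0 e2.
near=> z => t /=; rewrite (splitr e) -(subrKA (u0 (w z t))).
rewrite (le_lt_trans (ler_normD _ _))// ltrD//.
  by apply: Hd; move: t; near: z; exact: ww0.
by move: (w z t); near: z; exact: uu0.
Unshelve. all: by end_near. Qed.

Lemma ucvgV (u : T -> I -> R) (u0 : I -> R) : continuous u0 -> (forall t, u0 t != 0) ->
  continuous (fun t => (u0 t)^-1) ->
  ucvg u u0 -> ucvg (fun z t => (u z t)^-1) (fun t => (u0 t)^-1).
Proof.
move=> cu0 u00 cV uu0 e e0.
have [M M0 HM] := boundedI cV.
have u0M t : M^-1 <= `|u0 t|.
  have := HM t; rewrite normfV -(invrK M) ler_pV2 ?invrK//.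
    by rewrite inE unitfE normr_eq0 u00 normr_gt0 u00.
  by rewrite inE unitfE invr_eq0 gt_eqF// invr_gt0.
near=> z => t.
have h1 : `|u0 t - u z t| < M^-1 / 2.
  by move: t; near: z; apply: uu0; rewrite divr_gt0// invr_gt0.
have h2 : `|u0 t - u z t| < e / (M * (M * 2)).
  by move: t {h1}; near: z; apply: uu0; rewrite divr_gt0// !mulr_gt0.
have uM : (M * 2)^-1 <= `|u z t|.
  have : `|u0 t| <= `|u0 t - u z t| + `|u z t|.
    by rewrite (le_trans _ (ler_normD _ _))// subrK.
  rewrite -lerBlDl; apply: le_trans; rewrite lerBrDl.
  rewrite (le_trans _ (u0M t))// [leRHS](splitr M^-1) invfM lerD// ltW//.
have uz : u z t != 0.
  by rewrite -normr_gt0 (lt_le_trans _ uM)// invr_gt0 mulr_gt0.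
have -> : (u0 t)^-1 - (u z t)^-1 = (u z t - u0 t) * ((u0 t)^-1 * (u z t)^-1).
  rewrite mulrBl [u z t * _]mulrCA divff// mulr1 mulrA divff// mul1r//.
rewrite !normrM distrC.
rewrite (@le_lt_trans _ _ (`|u0 t - u z t| * (M * (M * 2))))//; last first.
  by rewrite -ltr_pdivlMr// !mulr_gt0.
rewrite ler_wpM2l// ler_pM//.
rewrite normfV -[leRHS]invrK lef_pV2// posrE ?normr_gt0//.
by rewrite invr_gt0 mulr_gt0.
Unshelve. all: by end_near. Qed.

Lemma cvg_HplusP (f : T -> Hplus R) (f0 : Hplus R) :
  f z @[z --> F] --> f0 <-> ucvg (fun z => set_val \o f z) (set_val \o f0).
Proof.
have H := fun g : Hplus R => @Hplus_val_continuous R g.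
split=> [/cvg_ballP ff0 e e0|ff0].
  near=> z => t; have : ball f0 e (f z) by near: z; exact: ff0.
  by rewrite ballEmdist; apply: le_lt_trans; exact: sup_dist_ge.
apply/cvg_ballP => e e0; near=> z; rewrite ballEmdist /=.
rewrite (@le_lt_trans _ _ (e / 2))//.
  apply: sup_dist_le => t; apply/ltW.
  by move: t; near: z; apply: ff0; rewrite divr_gt0.
by rewrite gtr_pMr// invf_lt1// ltr1n.
Unshelve. all: by end_near. Qed.

Lemma cvg_DiffP (f : T -> Diff R) (f0 : Diff R) :
  f z @[z --> F] --> f0 <->
  ucvg (fun z => set_val \o f z) (set_val \o f0) /\
  ucvg (fun z => Diff_deriv (f z)) (Diff_deriv f0).
Proof.
have H := fun g : Hplus R => @Hplus_val_continuous R g.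
have H' := fun g : Diff R => @Diff_deriv_continuous R g.
split=> [/cvg_ballP ff0|[ff0 ff0']].
  split=> e e0; near=> z => t.
    have : ball f0 e (f z) by near: z; exact: ff0.
    rewrite ballEmdist; apply: le_lt_trans.
    rewrite (le_trans (sup_dist_ge t (H _) (H _)))// lerDl.
    exact: sup_dist_ge0.
  have : ball f0 e (f z) by near: z; exact: ff0.
  rewrite ballEmdist; apply: le_lt_trans.
  rewrite (le_trans (sup_dist_ge t (H' _) (H' _)))// lerDr.
  exact: sup_dist_ge0.
apply/cvg_ballP => e e0; have e4 : 0 < e / 2 / 2 by rewrite !divr_gt0.
near=> z; rewrite ballEmdist /=.
rewrite (@le_lt_trans _ _ (e / 2))//.
  rewrite (splitr (e / 2)) lerD//; apply: sup_dist_le => t; apply/ltW.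
    by move: t; near: z; apply: ff0.
  by move: t; near: z; apply: ff0'.
by rewrite gtr_pMr// invf_lt1// ltr1n.
Unshelve. all: by end_near. Qed.

Lemma ucvg_inv (f : T -> Hplus R) (f0 : Hplus R) :
  ucvg (fun z => set_val \o f z) (set_val \o f0) ->
  ucvg (fun z => set_val \o (f z)^-1%g) (set_val \o f0^-1%g).
Proof.
move=> ff0 e e0.
have [d d0 Hd] := unif_ctsI (@Hplus_val_continuous R (f0^-1)%g) e0.
near=> z => t.
have -> : (set_val \o f0^-1%g) t - (set_val \o (f z)^-1%g) t =
    (set_val \o f0^-1%g) (f z ((f z)^-1%g t)) -
    (set_val \o f0^-1%g) (f0 ((f z)^-1%g t)).
  rewrite Hplus_invVK; congr (_ - _).
  exact: (congr1 set_val (esym (Hplus_invK f0 _))).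
apply: Hd; rewrite distrC.
by move: ((f z)^-1%g t); near: z; exact: ff0.
Unshelve. all: by end_near. Qed.

End UniformConvergence.

Section ShiftAction.
Variable R : realType.
Local Notation I := (unit_itv R).

Lemma Diff_mulE (f g : Diff R) : Diff_homeo (f * g)%g = (Diff_homeo f * g)%g.
Proof. by []. Qed.

Lemma Diff_invE (f : Diff R) : Diff_homeo (f^-1)%g = ((Diff_homeo f)^-1)%g.
Proof. by []. Qed.

Lemma Diff_deriv_mul (f g : Diff R) :
  Diff_deriv (f * g)%g = (fun t => Diff_deriv f (g t) * Diff_deriv g t).
Proof.
have [Cf _] := DiffP f; have [Cg _] := DiffP g.
by have [] := derivI_comp Cf Cg (can_inj (Hplus_invK g))
                         (@Hplus_continuous R g).
Qed.

Lemma Diff_deriv_inv (f : Diff R) t :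
  Diff_deriv f (f^-1%g t) * Diff_deriv (f^-1)%g t = 1.
Proof.
have := Diff_deriv_mul f (f^-1)%g; rewrite mulgV => /(congr1 (@^~ t)) <-.
have [_ E] := @derivI_id R.
by rewrite /Diff_deriv (_ : _ \o _ = set_val) ?E.
Qed.

Lemma Diff_deriv_neq0 (f : Diff R) t : Diff_deriv f t != 0.
Proof.
have := Diff_deriv_inv f (f t); rewrite Hplus_invK => /eqP.
by apply: contraTneq => ->; rewrite mul0r eq_sym oner_eq0.
Qed.

Lemma Diff_deriv_invE (f : Diff R) :
  Diff_deriv (f^-1)%g = fun t => (Diff_deriv f (f^-1%g t))^-1.
Proof.
apply/funext => t; apply: (mulfI (Diff_deriv_neq0 f (f^-1%g t))).
by rewrite Diff_deriv_inv divff// Diff_deriv_neq0.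
Qed.

Fact Diff_mul_continuous :
  continuous (fun p : Diff R * Diff R => (p.1 * p.2)%g).
Proof.
move=> [f g] /=; apply/cvg_DiffP.
have /cvg_DiffP[f1 f2] : p.1 @[p --> (f, g)] --> f by exact: cvg_fst.
have /cvg_DiffP[g1 g2] : p.2 @[p --> (f, g)] --> g by exact: cvg_snd.
split; first exact: ucvg_comp (@Hplus_val_continuous R f) f1 g1.
rewrite Diff_deriv_mul; under [X in ucvg _ X]eq_fun do rewrite Diff_deriv_mul.
apply: ucvgM => //; last first.
- exact: ucvg_comp (@Diff_deriv_continuous R f) f2 g1.
- exact: Diff_deriv_continuous.
apply: continuous_comp_all; first exact: Hplus_continuous.
exact: Diff_deriv_continuous.
Qed.

Fact Diff_inv_continuous : continuous (fun f : Diff R => (f^-1)%g).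
Proof.
move=> f; have FF : Filter (nbhs f) := nbhs_filter f.
apply/(@cvg_DiffP _ _ _ FF).
have /cvg_DiffP[f1 f2] : g @[g --> f] --> f by exact: cvg_id.
have fV := @ucvg_inv _ _ _ FF _ _ f1.
split; first exact: fV.
rewrite Diff_deriv_invE.
under [X in ucvg _ X]eq_fun do rewrite Diff_deriv_invE.
apply: ucvgV.
- apply: continuous_comp_all; first exact: Hplus_continuous.
  exact: Diff_deriv_continuous.
- by move=> t; exact: Diff_deriv_neq0.
- by rewrite -Diff_deriv_invE; exact: Diff_deriv_continuous.
- exact: ucvg_comp (@Diff_deriv_continuous R f) f2 fV.
Qed.

HB.instance Definition _ := isTopologicalGroup.Build (Diff R)
  Diff_mul_continuous Diff_inv_continuous.

Fact shift_continuous :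
  continuous (fun p : Diff R * Hplus R => (Diff_homeo p.1 * p.2)%g).
Proof.
move=> [f g] /=; apply/cvg_HplusP.
have /cvg_DiffP[f1 _] : p.1 @[p --> (f, g)] --> f by exact: cvg_fst.
have /cvg_HplusP g1 : p.2 @[p --> (f, g)] --> g by exact: cvg_snd.
exact: ucvg_comp (@Hplus_val_continuous R f) f1 g1.
Qed.

Definition shift_action : continuous_action (Diff R) (Hplus R) :=
  {| act := fun (g : Diff R) (h : Hplus R) => (Diff_homeo g * h)%g ;
     act1 := fun h => mul1g h ;
     actM := fun g g' h => esym (mulgA (Diff_homeo g) g' h) ;
     act_continuous := shift_continuous |}.

End ShiftAction.

(* Main.v *)
(* Smoothing a homeomorphism f by the sliding mean over [t(1+d) - d, t(1+d)],
   which keeps the endpoints fixed, and adding a small multiple of the identity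
   shows that Diff is dense in H+; hence orbits are dense.  The orbit of x is
   meager since each g in Diff satisfies g(u) <= n u for some n, while adding
   s sqrt(x) to (1-s) h destroys h <= n x for every n.  For the local orbits,
   if g x lies in a ball around x, then so does the segment (1-s) x + s g x,
   and it is traversed by the diffeomorphisms k_s = (1-s) id + s g: the steps
   k_s' k_s^-1 are close to 1 in Diff when s' is close to s, because the
   derivatives of the k_s are uniformly bounded away from 0. *)
Require Import Defs.
From HB Require Import structures.
From mathcomp Require Import all_boot all_order all_algebra.
From mathcomp Require Import all_classical all_reals all_analysis.
From mathcomp Require Import ring lra.

Set Implicit Arguments.
Unset Strict Implicit.
Unset Printing Implicit Defensive.

Import Order.TTheory GRing.Theory Num.Theory.
Import numFieldNormedType.Exports.
Local Open Scope classical_set_scope.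
Local Open Scope ring_scope.

(** * Homeomorphisms and diffeomorphisms from real functions on the interval *)

Section Homeomorphisms.
Context {R : realType}.
Local Notation I := (unit_itv R).
Implicit Types (F G : I -> R) (x y t : I).

Fact clampI_subproof (r : R) : 0 <= Num.max 0 (Num.min 1 r) <= 1.
Proof. by rewrite le_max lexx ge_max ler01 ge_min lexx. Qed.

(** The retraction of the line onto the interval. It extends functions on [I] to [R], where
    integration and the intermediate value theorem are at hand; [clampI 0] and [clampI 1] serve as
    the endpoints of [I]. *)
Definition clampI (r : R) : I := mkI (clampI_subproof r).

Lemma clampIE (r : R) : set_val (clampI r) = Num.max 0 (Num.min 1 r).
Proof. exact: mkIE. Qed.

Lemma clampI_id (r : R) : 0 <= r <= 1 -> set_val (clampI r) = r.
Proof. by case/andP=> r0 r1; rewrite clampIE (min_idPr r1) (max_idPr r0). Qed.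

Lemma clampI_le0 (r : R) : r <= 0 -> set_val (clampI r) = 0.
Proof. by move=> r0; rewrite clampIE (max_idPl _)// ge_min r0 orbT. Qed.

Lemma clampI_ge1 (r : R) : 1 <= r -> set_val (clampI r) = 1.
Proof. by move=> r1; rewrite clampIE (min_idPl r1) (max_idPr ler01). Qed.

Lemma clampIK x : clampI (set_val x) = x.
Proof. by apply: set_val_inj; rewrite clampI_id// set_val01. Qed.

Lemma clampI_dist (r s : R) :
  `|set_val (clampI r) - set_val (clampI s)| <= `|r - s|.
Proof.
have h1 := ler_norm (r - s); have := ler_norm (s - r); rewrite distrC => h2.
have [r0|r0] := leP r 0; have [s0|s0] := leP s 0;
  have [r1|r1] := leP 1 r; have [s1|s1] := leP 1 s;
  rewrite ?(clampI_le0 r0) ?(clampI_le0 s0) ?(clampI_ge1 r1) ?(clampI_ge1 s1)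
    ?(@clampI_id r) ?(@clampI_id s) ?(ltW r0) ?(ltW r1) ?(ltW s0) ?(ltW s1)//;
  rewrite ler_norml; apply/andP; split; lra.
Qed.

Lemma continuous_clampI : continuous clampI.
Proof.
move=> r A /nbhsI[e e0 eA]; apply/nbhs_ballP; exists e => // s rs.
exact/eA/(le_lt_trans (clampI_dist r s)).
Qed.

(** Surjectivity comes from the intermediate value theorem; the inverse is continuous because a
    continuous map from a compact space to a Hausdorff space is closed. *)
Lemma Hplus_exists F : continuous F ->
  {homo F : x y / set_val x < set_val y >-> x < y} ->
  F (clampI 0) = 0 -> F (clampI 1) = 1 ->
  exists k : Hplus R, forall t, set_val (k t) = F t.
Proof.
move=> cF mF F0 F1.
have mleF x y : set_val x <= set_val y -> F x <= F y.
  by rewrite le_eqVlt => /predU1P[/set_val_inj ->//|/mF/ltW].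
have F01 x : 0 <= F x <= 1.
  have /andP[x0 x1] := set_val01 x.
  by rewrite -{1}F0 -F1 !mleF ?(clampI_le0 (lexx _)) ?(clampI_ge1 (lexx _)).
pose k x : I := mkI (F01 x).
have kE x : set_val (k x) = F x by exact: mkIE.
have ck : continuous k.
  by apply: cts_set_val; rewrite (_ : _ \o _ = F)//; apply/funext.
have F_surj y : exists x, k x = y.
  have [|||r _ ry] := @IVT R (F \o clampI) 0 1 (set_val y).
  - exact: ler01.
  - apply: continuous_subspaceT.
    exact: continuous_comp_all continuous_clampI cF.
  - have /andP[y0 y1] := set_val01 y.
    by rewrite /= F0 F1 (min_idPl ler01) (max_idPr ler01) y0 y1.
  by exists (clampI r); apply: set_val_inj; rewrite kE.
pose g y := projT1 (cid (F_surj y)).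
have gK : cancel g k by move=> y; rewrite /g; case: cid.
have k_inj : injective k.
  move=> x y /(congr1 set_val); rewrite !kE => xy; apply: set_val_inj.
  by case: (ltgtP (set_val x) (set_val y)) => // /mF; rewrite xy ltxx.
have kK : cancel k g by move=> x; apply: k_inj; rewrite gK.
have cg : continuous g.
  apply/continuous_closedP => A cA.
  have -> : g @^-1` A = k @` A.
    apply/seteqP; split=> [y Ay|_ [x Ax <-]]; first by exists (g y).
    by rewrite /= kK.
  have -> : k @` A = set_val @^-1` ((set_val \o k) @` A).
    apply/seteqP; split=> [_ [x Ax <-]|y [x Ax /set_val_inj <-]].
      by exists x.
    by exists x.
  apply: (iffLR (continuous_closedP _) (@set_val_cts R)).
  apply: (compact_closed (@Rhausdorff R)); apply: continuous_compact.
    exact/continuous_subspaceT/(proj1 (ctsIP k)).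
  exact: subclosed_compact cA compactI _.
have kP : incr_homeo k.
  by split=> //; exists g.
by exists (mk_Hplus kP).
Qed.

Lemma Hplus_lt (f : Hplus R) x y :
  set_val x < set_val y -> set_val (f x) < set_val (f y).
Proof. by have [f1 _ _] := HplusP f; exact: f1. Qed.

Lemma Hplus_le (f : Hplus R) x y :
  set_val x <= set_val y -> set_val (f x) <= set_val (f y).
Proof.
by rewrite le_eqVlt => /predU1P[/set_val_inj ->//|/(Hplus_lt f)/ltW].
Qed.

Lemma Hplus0 (f : Hplus R) : set_val (f (clampI 0)) = 0.
Proof.
apply/eqP; rewrite eq_le; have /andP[-> _] := set_val01 (f (clampI 0)).
have /andP[y0 _] := set_val01 (f^-1%g (clampI 0)).
have := @Hplus_le f (clampI 0) (f^-1%g (clampI 0)).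
by rewrite Hplus_invVK (clampI_le0 (lexx 0)) andbT; exact.
Qed.

Lemma Hplus1 (f : Hplus R) : set_val (f (clampI 1)) = 1.
Proof.
apply/eqP; rewrite eq_le; have /andP[_ ->] := set_val01 (f (clampI 1)).
have /andP[_ y1] := set_val01 (f^-1%g (clampI 1)).
have := @Hplus_le f (f^-1%g (clampI 1)) (clampI 1).
by rewrite Hplus_invVK (clampI_ge1 (lexx 1)); exact.
Qed.

(** [F y - F x] is the difference quotient times [y - x], a convergent factor times one that tends
    to 0. *)
Lemma C1_continuous F : C1 F -> continuous F.
Proof.
move=> [F1 _] x.
have H := F1 x.
have : (F y - F x) @[y --> x^'] --> derivI F x * 0.
  have v : (set_val y - set_val x : R) @[y --> x^'] --> (0 : R).
    apply/cvgrPdist_lt => e e0 /=.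
    by apply/nbhsI; exists e => // y xy _; rewrite sub0r normrN distrC.
  apply: (cvg_trans _ (@cvgM _ _ _ (dnbhs_filter x) _ _ _ _ H v)).
  apply: near_eq_cvg; apply/nbhsI; exists 1 => // y _ yx.
  rewrite /diff_quot /= mulfVK// subr_eq0.
  by apply: contra_neq yx => /set_val_inj.
rewrite mulr0 => /cvgrPdist_lt H2 A /nbhs_ballP[e e0 eA].
have /nbhsI[d d0 Hd] := H2 _ e0; apply/nbhsI; exists d => // y xy; apply: eA.
have [->|yx] := eqVneq y x; first exact: ballxx.
by have := Hd y xy yx; rewrite sub0r normrN distrC.
Qed.

Lemma continuous_linear (T : topologicalType) (a b : R) (u v : T -> R) :
  continuous u -> continuous v -> continuous (fun z => a * u z + b * v z).
Proof.
move=> cu cv z.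
exact: (cvgD (cvgM (@cvg_cst _ a _ _ _) (cu z))
             (cvgM (@cvg_cst _ b _ _ _) (cv z))).
Qed.

Lemma C1_linear (a b : R) F G : C1 F -> C1 G ->
  C1 (fun t => a * F t + b * G t) /\
  derivI (fun t => a * F t + b * G t) =
    (fun t => a * derivI F t + b * derivI G t).
Proof.
move=> [F1 F2] [G1 G2]; apply: C1_witness => [|x].
  exact: continuous_linear.
have FF := dnbhs_filter x.
apply: (cvg_trans _ (cvgD (cvgM (cvg_cst a) (derivI_cvg (F1 x)))
                          (cvgM (cvg_cst b) (derivI_cvg (G1 x))))).
apply: near_eq_cvg; apply: nearW => y; rewrite /diff_quot /=.
set d := (set_val y - set_val x)^-1.
rewrite -[LHS]/(a * ((F y - F x) * d) + b * ((G y - G x) * d)); ring.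
Qed.

(* The difference quotient of the inverse is the inverse of the difference
   quotient, taken at the preimages. *)
Lemma C1_diffeo (k : Hplus R) : C1 (set_val \o k) ->
  (forall t, derivI (set_val \o k) t != 0) -> diffeo k.
Proof.
move=> Ck dk; split=> //; have [k1 k2] := Ck.
pose g : Hplus R := k^-1%g.
have [] // := @C1_witness R (set_val \o g)
  (fun t => (derivI (set_val \o k) (g t))^-1).
  move=> x; have FF := nbhs_filter x.
  have c : continuous (fun t => derivI (set_val \o k) (g t)).
    exact: (continuous_comp_all (@Hplus_continuous R g) k2).
  exact: (cvgV (dk _) (c x)).
move=> x.
have H1 : diff_quot (set_val \o k) (g x) (g y) @[y --> x^'] -->
    derivI (set_val \o k) (g x).
  apply: (cvg_comp _ _ _ (k1 (g x))) => A /= kA.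
  have := @Hplus_continuous R g x _ kA; rewrite /= /nbhs /= => H.
  rewrite /dnbhs /within /= in H *.
  apply: (@filterS _ _ (nbhs_filter x) _ _ _ H) => y Hy yx; apply: Hy.
  by apply: contra_neq yx => /(can_inj (Hplus_invVK k)).
apply: (cvg_trans _ (cvgV (dk (g x)) H1)).
apply: near_eq_cvg; apply: nearW => y.
by rewrite /diff_quot /= !Hplus_invVK invf_div.
Qed.

Lemma Diff_exists F : C1 F ->
  {homo F : x y / set_val x < set_val y >-> x < y} ->
  F (clampI 0) = 0 -> F (clampI 1) = 1 -> (forall t, derivI F t != 0) ->
  exists k : Diff R,
    (forall t, set_val (k t) = F t) /\ Diff_deriv k = derivI F.
Proof.
move=> CF mF F0 F1 dF.
have [k kF] := Hplus_exists (C1_continuous CF) mF F0 F1.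
have kE : set_val \o k = F by apply/funext => t; exact: kF.
have kP : diff_pred k by apply/asboolP/C1_diffeo; rewrite kE.
by exists (MkDiff kP); split=> //; rewrite /Diff_deriv kE.
Qed.

End Homeomorphisms.

(** * Uniform approximation of homeomorphisms by diffeomorphisms *)

Section Density.
Context {R : realType}.
Local Notation I := (unit_itv R).

(** Subtracting [x] carries the punctured neighbourhood filter of [x] in [I] into that of 0 in [R],
    so two-sided derivatives restrict to derivatives within [I]. *)
Lemma C1_is_derive (G dG : R -> R) : continuous dG ->
  (forall t : I, is_derive (set_val t) 1 G (dG (set_val t))) ->
  C1 (G \o set_val : I -> R) /\
  derivI (G \o set_val : I -> R) = dG \o set_val.
Proof.
move=> cdG dGE; apply: C1_witness => [|x].
  exact: (continuous_comp_all (@set_val_cts R) cdG).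
have [dG1 dG2] := dGE x.
move: dG1 => /cvg_ex[l]; rewrite /= => Hl.
have lE : l = dG (set_val x) by rewrite -dG2; apply/esym/cvg_lim.
have FF := dnbhs_filter x.
have v : (set_val y - set_val x : R) @[y --> x^'] --> (0 : R)^'.
  move=> A /nbhs_ballP[e e0 eA]; apply/nbhsI; exists e => // y xy yx.
  apply: eA; first by rewrite /ball /= sub0r normrN distrC.
  by rewrite subr_eq0; apply: contra_neq yx => /set_val_inj.
rewrite -lE.
apply: cvg_trans (cvg_comp _ _ v Hl).
apply: near_eq_cvg; apply: nearW => y; rewrite /diff_quot /=.
by rewrite scaler1 subrK mulrC.
Qed.

Lemma antiderivative (f : R -> R) (a : R) : continuous f ->
  exists F : R -> R, forall x, a < x -> is_derive x 1 F (f x).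
Proof.
move=> cf.
exists (fun x => \int[lebesgue_measure]_(t in `[a, x]) f t)%R => x ax.
have [] := @continuous_FTC1 R f (BLeft a) x (x + 1) _ _ _ (cf x).
- by rewrite ltrDl.
- apply: continuous_compact_integrable; first exact: segment_compact.
  exact: continuous_subspaceT.
- by rewrite lte_fin.
by move=> F1 F2; apply: DeriveDef; [exact: F1|rewrite -derive1E; exact: F2].
Qed.

Lemma MVT_closed (F f : R -> R) (a b : R) : a < b ->
  (forall x, a <= x <= b -> is_derive x 1 F (f x)) ->
  exists2 c, a < c < b & F b - F a = f c * (b - a).
Proof.
move=> ab dF; have [x /subset_itv_oo_cc xab||c] := @MVT R F f a b ab.
- exact: dF.
- apply: derivable_within_continuous => y; rewrite in_itv => /dF yab.
  exact: ex_derive.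
by rewrite in_itv; exists c.
Qed.

(** The sliding mean is close to [f] by uniform continuity and nondecreasing because [f] is; the
    added multiple of the identity makes the derivative positive. *)
Lemma Diff_approx (f : Hplus R) (e : R) : 0 < e -> e < 1 ->
  exists k : Diff R, forall t, `|set_val (f t) - set_val (k t)| < e.
Proof.
move=> e0 e1; have e20 : 0 < e / 2 by rewrite divr_gt0.
have [d0 d00 Hd0] := unif_ctsI (@Hplus_val_continuous R f) e20.
(* [d < d0] makes [f] vary by less than [e / 2] over a window of length [d]; [d <= 1] keeps all
   windows to the right of -2, where [F] is differentiable. *)
have [d [dgt0 d1 dd0]] : exists d, [/\ 0 < d, d <= 1 & d < d0].
  exists (Num.min (d0 / 2) 1); rewrite lt_min divr_gt0// ltr01 ge_min lexx orbT.
  by split=> //; rewrite gt_min; apply/orP; left; lra.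
pose u (r : R) : R := set_val (f (clampI r)).
have cu : continuous u.
  exact: (continuous_comp_all (@continuous_clampI R)
                              (@Hplus_val_continuous R f)).
have mu r s : r <= s -> u r <= u s.
  move=> rs; apply: Hplus_le; rewrite !clampIE.
  by rewrite ge_max le_max lexx/= le_max le_min !ge_min lexx rs !orbT.
have [F dF] := antiderivative (-2) cu.
(* As [F] is an antiderivative of [u], the factor of [1 - e / 2] is the mean of [u] over the
   window. *)
pose G (r : R) : R :=
  (1 - e / 2) * (d^-1 * (F ((1 + d) * r) - F ((1 + d) * r - d))) + e / 2 * r.
pose dG (r : R) : R :=
  (1 - e / 2) * (d^-1 * ((1 + d) * (u ((1 + d) * r) - u ((1 + d) * r - d))))
    + e / 2.
have dGE (r : R) : 0 <= r -> is_derive r 1 G (dG r).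
  move=> r0.
  have dF1 : is_derive ((1 + d) * r) 1 F (u ((1 + d) * r)) by apply: dF; nra.
  have dF2 : is_derive ((1 + d) * r - d) 1 F (u ((1 + d) * r - d)).
    by apply: dF; nra.
  have dl : is_derive r 1 (fun s : R => (1 + d) * s) (1 + d).
    exact: (is_derive_eq (is_deriveZ (1 + d) (is_derive_id r 1)) (mulr1 _)).
  have dm : is_derive r 1 (fun s : R => (1 + d) * s - d) (1 + d).
    exact: (is_derive_eq (is_deriveB dl (is_derive_cst d r 1)) (subr0 _)).
  have := is_deriveZ (e / 2) (is_derive_id r 1).
  have dFl := @is_derive1_comp R F (fun s => (1 + d) * s) r _ _ dF1 dl.
  have := is_deriveB dFl
    (@is_derive1_comp R F (fun s => (1 + d) * s - d) r _ _ dF2 dm).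
  move=> /(is_deriveZ d^-1)/(is_deriveZ (1 - e / 2))/is_deriveD H /H.
  move=> /is_derive_eq; apply; rewrite /dG /GRing.scale/= mulr1.
  by congr (_ * (_ * _) + _); ring.
have dG_gt0 (r : R) : 0 < dG r.
  rewrite ltr_wpDl// !mulr_ge0 ?invr_ge0 ?subr_ge0 ?(ltW dgt0)//; try lra.
  by apply: mu; lra.
(* By the mean value theorem for [F], the mean is a value of [u] inside the window. *)
have mean (r : R) : 0 <= r <= 1 ->
    exists2 c, (1 + d) * r - d < c < (1 + d) * r &
      G r = (1 - e / 2) * u c + e / 2 * r.
  move=> /andP[r0 r1].
  have [|x /andP[x1 _]|c cd] := @MVT_closed F u ((1 + d) * r - d) ((1 + d) * r).
  - lra.
  - by apply: dF; nra.
  rewrite /G => ->; exists c => //.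
  by congr (_ * _ + _); field; rewrite gt_eqF.
have cdG : continuous dG.
  have cM (a : R) (v : R -> R) : continuous v -> continuous (fun r => a * v r).
    move=> cv r; exact: (cvgM (@cvg_cst _ a _ _ _) (cv r)).
  have cB (v w : R -> R) : continuous v -> continuous w ->
      continuous (fun r => v r - w r).
    move=> cv cw r; exact: (cvgB (cv r) (cw r)).
  have cl : continuous (fun r : R => (1 + d) * r).
    by apply: cM => r; exact: cvg_id.
  have cm : continuous (fun r : R => (1 + d) * r - d).
    by apply: cB => // r; exact: cvg_cst.
  have cW := cM _ _ (cM d^-1 _ (cM (1 + d) _
    (cB _ _ (continuous_comp_all cl cu) (continuous_comp_all cm cu)))).
  move=> r; exact: (cvgD (cW _ r) (@cvg_cst _ (e / 2) _ _ _)).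
have dGI (t : I) : is_derive (set_val t) 1 G (dG (set_val t)).
  by apply: dGE; have /andP[] := set_val01 t.
have [CG dGIE] := C1_is_derive cdG dGI.
have [||||k [kG _]] := Diff_exists CG.
- move=> x y xy; have /andP[x0 _] := set_val01 x; rewrite /= -subr_gt0.
  have [t /andP[xt _]|c _ ->] :=
    MVT_closed xy (_ : forall t : R, _ -> is_derive t 1 G (dG t)).
    exact/dGE/(le_trans x0).
  by rewrite mulr_gt0// subr_gt0.
(* At 0 the window lies left of 0, where [u] is 0; at 1, treated next, it lies right of 1, where [u]
   is 1. *)
- rewrite /= (clampI_le0 (lexx 0)).
  have [|c /andP[_ c0] ->] := mean 0; first by rewrite lexx ler01.
  rewrite /u (_ : clampI c = clampI 0) ?Hplus0 ?mulr0 ?addr0//.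
  by apply: set_val_inj; rewrite !clampI_le0//; lra.
- rewrite /= (clampI_ge1 (lexx 1)).
  have [|c /andP[c0 _] ->] := mean 1; first by rewrite lexx ler01.
  rewrite /u (_ : clampI c = clampI 1) ?Hplus1 ?mulr1 ?subrK//.
  by apply: set_val_inj; rewrite !clampI_ge1//; lra.
- by move=> t; rewrite dGIE gt_eqF//; exact: dG_gt0.
exists k => t; rewrite kG /=; have t01 := set_val01 t.
have [c cd ->] := mean _ t01.
(* The window has length [d] and contains both [t] and [c]. *)
have fu : `|set_val (f t) - u c| < e / 2.
  apply: Hd0; rewrite -{1}(clampIK t).
  apply: le_lt_trans (clampI_dist _ _) _; apply: le_lt_trans dd0.
  rewrite ler_norml; apply/andP; split; nra.
have ft : `|set_val (f t) - set_val t| <= 1.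
  by have := set_val01 (f t); rewrite ler_norml; lra.
(* The error is below [(1 - e / 2) * (e / 2) + e / 2], which is less than [e]. *)
rewrite (_ : _ - _ = (1 - e / 2) * (set_val (f t) - u c)
                     + e / 2 * (set_val (f t) - set_val t)); last ring.
rewrite (le_lt_trans (ler_normD _ _))// (normrM (1 - _)) (normrM (e / 2)).
rewrite (gtr0_norm e20) (@gtr0_norm _ (1 - e / 2)); last lra.
by have := normr_ge0 (set_val (f t) - u c); nra.
Qed.

End Density.

(** * Dense orbits *)

Section Turbulent.
Context {R : realType}.
Local Notation I := (unit_itv R).
Implicit Types (x h : Hplus R) (k g : Diff R).

Lemma Hplus_ballP x h (e : R) : ball x e h ->
  forall t, `|set_val (x t) - set_val (h t)| < e.
Proof.
rewrite ballEmdist => xh t; apply: le_lt_trans xh.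
by apply: (sup_dist_ge t); exact: Hplus_val_continuous.
Qed.

Lemma Hplus_ball x h (d e : R) : d < e ->
  (forall t, `|set_val (x t) - set_val (h t)| <= d) -> ball x e h.
Proof.
by move=> de xh; rewrite ballEmdist; apply: le_lt_trans de; exact: sup_dist_le.
Qed.

(** Composition with [x] on the right preserves uniform distance, so it suffices to approximate
    [h * x^-1] by a diffeomorphism. *)
Lemma orbit_approx x h (e : R) : 0 < e ->
  exists k, ball h e (Diff_homeo k * x)%g.
Proof.
move=> e0; pose d := Num.min (e / 2) (1 / 2).
have d0 : 0 < d by rewrite lt_min !divr_gt0.
have d1 : d < 1 by rewrite gt_min; apply/orP; right; lra.
have de : d < e by rewrite gt_min; apply/orP; left; lra.
have [k Hk] := Diff_approx (h * x^-1)%g d0 d1.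
exists k; apply: Hplus_ball de _ => t.
have E : (h * x^-1)%g (x t) = h t := congr1 h (Hplus_invK x t).
by have /ltW := Hk (x t); rewrite E.
Qed.

Lemma dense_orbit x : dense (Defs.orbit (shift_action R) x).
Proof.
move=> U [h Uh] oU.
have /nbhs_ballP[e e0 eU] := open_nbhs_nbhs (conj oU Uh).
have [k Hk] := orbit_approx x h e0.
by exists (Diff_homeo k * x)%g; split; [exact: eU|exists k].
Qed.

(** * Local orbits and segments of diffeomorphisms *)

Lemma Diff_deriv_gt0 k t : 0 < Diff_deriv k t.
Proof.
rewrite lt_neqAle eq_sym Diff_deriv_neq0 /=.
have [[k1 _] _] := DiffP k.
(* The derivative is nonzero, so it is enough that the difference quotients of an increasing map are
   nonnegative. *)
apply: limr_ge; first exact: k1.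
apply: nearW => y; rewrite /diff_quot /=.
have [ty|ty|/set_val_inj ->] := ltgtP (set_val t) (set_val y).
- by rewrite divr_ge0// subr_ge0 ltW// Hplus_lt.
- by rewrite -mulrNN -invrN !opprB divr_ge0// subr_ge0 ltW// Hplus_lt.
- by rewrite !subrr mul0r.
Qed.

(** Increments and derivatives are convex combinations of positive numbers, hence positive, also for
    [s] equal to 0 or 1. *)
Lemma Diff_segment k (s : R) : 0 <= s <= 1 ->
  exists g, (forall t, set_val (g t) = (1 - s) * set_val t + s * set_val (k t))
    /\ Diff_deriv g = fun t => (1 - s) + s * Diff_deriv k t.
Proof.
move=> /andP[s0 s1]; have [Cid did] := @derivI_id R; have [Ck _] := DiffP k.
have [CF dF] := C1_linear (1 - s) s Cid Ck.
have dFE : derivI (fun t : I => (1 - s) * set_val t + s * (set_val \o k) t) =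
    fun t => (1 - s) + s * Diff_deriv k t.
  by rewrite dF did; apply/funext => t; rewrite mulr1.
have conv (a b : R) : 0 < a -> 0 < b -> 0 < (1 - s) * a + s * b.
  move=> a0 b0; have [->|sn1] := eqVneq s 1.
    by rewrite subrr mul0r add0r mul1r.
  by rewrite ltr_pwDl ?mulr_gt0 ?mulr_ge0 ?subr_gt0 ?(ltW b0)// lt_neqAle sn1.
have [||||g [gE dg]] := Diff_exists CF.
- move=> t u tu /=; rewrite -subr_gt0.
  rewrite [ltRHS](_ : _ = (1 - s) * (set_val u - set_val t)
    + s * (set_val (k u) - set_val (k t))); last ring.
  by rewrite conv ?subr_gt0//; exact: Hplus_lt.
- by rewrite /= Hplus0 (clampI_le0 (lexx 0)) !mulr0 addr0.
- by rewrite /= Hplus1 (clampI_ge1 (lexx 1)) !mulr1 subrK.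
- by move=> t; rewrite dFE gt_eqF// -[1 - s]mulr1 conv ?Diff_deriv_gt0.
by exists g; split=> //; rewrite dg dFE.
Qed.

(** The reciprocal of the derivative is the derivative of the inverse at the image point, which is
    bounded by compactness. *)
Lemma Diff_deriv_lbound k :
  exists2 m : R, 0 < m & forall t, m <= Diff_deriv k t.
Proof.
have [M M0 HM] := boundedI (@Diff_deriv_continuous R k^-1%g).
exists M^-1; first by rewrite invr_gt0.
move=> t; have := HM (k t).
have := Diff_deriv_inv k (k t); rewrite Diff_invE Hplus_invK => kV kM.
rewrite -div1r ler_pdivrMr// -kV ler_pM2l ?Diff_deriv_gt0//.
exact: le_trans (ler_norm _) kM.
Qed.

Lemma Diff_ball1 g (d e : R) : d + d < e ->
  (forall t, `|set_val t - set_val (g t)| <= d) ->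
  (forall t, `|1 - Diff_deriv g t| <= d) -> ball (1%g : Diff R) e g.
Proof.
move=> de gd dgd; rewrite ballEmdist; apply: le_lt_trans de.
apply: lerD; apply: sup_dist_le => t; first exact: gd.
by have [_ E] := @derivI_id R; rewrite [Diff_deriv 1%g]E; exact: dgd.
Qed.

(** The segment from the identity to [k] is cut into [n] equal pieces; consecutive points of the
    path differ by [K i.+1 * (K i)^-1], which is close to 1 once [n] is large. *)
Lemma segment_path x k (r d : R) : 0 < r -> 0 < d ->
    ball x r (Diff_homeo k * x)%g ->
  exists (n : nat) (p : nat -> Hplus R) (g : nat -> Diff R),
    [/\ p 0%N = x, p n = (Diff_homeo k * x)%g,
        forall i, (i <= n)%N -> ball x r (p i),
        forall i, (i < n)%N -> ball (1%g : Diff R) d (g i) &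
        forall i, (i < n)%N -> p i.+1 = (Diff_homeo (g i) * p i)%g].
Proof.
move=> r0 d0 xk; have [m m0 mk] := Diff_deriv_lbound k.
have [N N0 Nk] := boundedI (@Diff_deriv_continuous R k).
(* A common lower bound for 1 and the derivative of [k], hence for the derivative of every point of
   the segment. *)
pose m' := Num.min m 1.
have m'0 : 0 < m' by rewrite lt_min m0 ltr01.
have m'k t : m' <= Diff_deriv k t by rewrite (le_trans _ (mk t))// ge_min lexx.
have m'1 : m' <= 1 by rewrite ge_min lexx orbT.
(* For a step of length [w], the derivative moves by at most [(1 + N) / m' * w] and the values by at
   most [w]; [c * w] covers both. *)
pose c := (1 + N) / m' + 1.
have Nm0 : 0 < (1 + N) / m' by rewrite divr_gt0// addr_gt0.
have cd0 : 0 <= c * 3 / d by rewrite divr_ge0// ?mulr_ge0 ?addr_ge0// ltW.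
pose n := (Num.bound (c * 3 / d)).+1.
have cn : c * 3 / d < n%:R.
  by rewrite (lt_trans (archi_boundP cd0))// ltr_nat.
have n0 : 0 < n%:R :> R by rewrite ltr0n.
pose w : R := n%:R^-1.
have w0 : 0 < w by rewrite invr_gt0.
have wn : n%:R * w = 1 by rewrite divff// gt_eqF.
have wc : c * w <= d / 3.
  have : w * (c * 3) <= w * (n%:R * d).
    by apply: ler_wpM2l; [exact: ltW|rewrite -ler_pdivrMr//; exact: ltW].
  by rewrite !mulrA [w * n%:R]mulrC wn mul1r [w * c]mulrC -ler_pdivlMr.
pose s i : R := i%:R * w.
have s01 i : (i <= n)%N -> 0 <= s i <= 1.
  move=> i_n; rewrite mulr_ge0 ?(ltW w0)//= -wn ler_wpM2r ?(ltW w0)//.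
  by rewrite ler_nat.
have sS i : s i.+1 = s i + w by rewrite /s -natr1 mulrDl mul1r.
have s0 : s 0%N = 0 by rewrite /s mul0r.
(* Beyond [n] the choice of [K] is arbitrary, with default 1. *)
have /choice[K HK] : forall i, exists g, (i <= n)%N ->
    (forall t, set_val (g t) = (1 - s i) * set_val t + s i * set_val (k t))
    /\ Diff_deriv g = fun t => (1 - s i) + s i * Diff_deriv k t.
  move=> i.
  have [i_n|_] := boolP (i <= n)%N; last by exists 1%g.
  by have [g Hg] := Diff_segment k (s01 i i_n); exists g.
exists n, (fun i => (Diff_homeo (K i) * x)%g), (fun i => (K i.+1 * (K i)^-1)%g).
split.
- have [K0 _] := HK 0%N (leq0n _).
  apply: HplusE => t; apply: set_val_inj.
  by rewrite Hplus_mulE /= K0 s0 subr0 mul1r mul0r addr0.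
- have [Kn _] := HK n (leqnn _).
  apply: HplusE => t; apply: set_val_inj.
  by rewrite Hplus_mulE /= Kn /s wn subrr mul0r add0r mul1r.
- move=> i i_n; have [Ki _] := HK i i_n; have /andP[si0 si1] := s01 i i_n.
  have xk' := xk; rewrite ballEmdist /= in xk'.
  apply: (Hplus_ball xk') => t.
  rewrite Hplus_mulE /= Ki.
  (* The distance from [x] to the [i]-th point is at most that from [x] to [k * x]. *)
  rewrite (_ : _ - _ = s i * (set_val (x t) - set_val (k (x t)))); last ring.
  rewrite normrM (ger0_norm si0) (le_trans (ler_piMl (normr_ge0 _) si1))//.
  by apply: (sup_dist_ge t); exact: Hplus_val_continuous.
- move=> i i_n; have [Ki dKi] := HK i (ltnW i_n); have [KS dKS] := HK i.+1 i_n.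
  have /andP[si0 si1] := s01 i (ltnW i_n).
  have c1 : w * 1 <= d / 3.
    by rewrite (le_trans _ wc)// mulrC ler_wpM2r ?(ltW w0)// lerDr ltW.
  (* Values and derivatives each contribute at most [d / 3]. *)
  apply: (@Diff_ball1 _ (d / 3)) => [|t|t]; first lra; last first.
    rewrite Diff_deriv_mul Diff_deriv_invE.
    move: ((K i)^-1%g t) => v; rewrite dKS dKi sS; set a := _ + s i * _.
    have am : m' <= a by rewrite /a; have := m'k v; nra.
    have a0 : 0 < a by rewrite (lt_le_trans m'0).
    (* At [v], the preimage of [t] under [K i], the derivative of the step is the quotient of the
       two derivatives, with denominator [a]. *)
    rewrite (_ : 1 - _ = w * ((1 - Diff_deriv k v) / a)); last first.
      by rewrite /a; field; rewrite gt_eqF.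
    rewrite (le_trans _ wc)// mulrC normrM (gtr0_norm w0) ler_wpM2r ?(ltW w0)//.
    apply: (@le_trans _ _ ((1 + N) / m')); last by rewrite lerDl.
    rewrite normrM ler_pM// ?normfV ?(gtr0_norm a0) ?lef_pV2 ?posrE//.
    rewrite (le_trans (ler_normB _ _))// normr1 lerD2l; exact: Nk.
  have tE : set_val t = set_val (K i ((K i)^-1%g t)) by rewrite Hplus_invVK.
  rewrite -[Hplus_fun _ t]/(K i.+1 ((K i)^-1%g t)) tE.
  move: ((K i)^-1%g t) => v {tE}; rewrite KS Ki sS.
  rewrite (_ : _ - _ = w * (set_val v - set_val (k v))); last ring.
  rewrite (le_trans _ c1)// normrM (gtr0_norm w0) ler_wpM2l ?(ltW w0)//.
  have := set_val01 v; have := set_val01 (k v).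
  by rewrite ler_norml; lra.
- by move=> i i_n; rewrite Diff_mulE Diff_invE mulgA mulgVK.
Qed.

(** The whole ball of radius [r] lies in the closure: its points are limits of orbit points in the
    same ball, and these are reached along segments. *)
Lemma somewhere_dense_local_orbit (U : set (Hplus R)) x (V : set (Diff R)) :
  open U -> U x -> open V -> V 1%g ->
  somewhere_dense (local_orbit (shift_action R) x U V).
Proof.
move=> oU Ux oV V1.
have /nbhs_ballP[r r0 rU] := open_nbhs_nbhs (conj oU Ux).
have /nbhs_ballP[d d0 dV] := open_nbhs_nbhs (conj oV V1).
exists x.
apply: (@filterS _ _ (nbhs_filter x) _ _ _ (nbhsx_ballx x r r0)) => h xh B.
rewrite ballEmdist /= in xh.
move=> /nbhs_ballP[e e0 eB].
(* An error below [r - mdist x h] keeps the approximant in the ball around [x]. *)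
have er0 : 0 < Num.min e (r - mdist x h) by rewrite lt_min e0 subr_gt0.
have [k] := orbit_approx x h er0; rewrite ballEmdist /= lt_min => /andP[hk xk].
have xkr : ball x r (Diff_homeo k * x)%g.
  rewrite ballEmdist /= (le_lt_trans (Hplus_dist_triangle h _ _))//.
  by rewrite -ltrBrDl.
exists (Diff_homeo k * x)%g; split; last by apply: eB; rewrite ballEmdist.
have [n [p [g [p0 pn pB gB pS]]]] := segment_path r0 d0 xkr.
split; first exact: rU.
by exists n, p, g; split=> // i i_n; [exact/rU/pB|exact/dV/gB].
Qed.

(** * Meager orbits *)

Lemma Diff_linear_bound k : exists n : nat,
  forall t, set_val (k t) <= n%:R * set_val t.
Proof.
have [[k1 _] _] := DiffP k.
have t0 : set_val (clampI 0) = 0 := clampI_le0 (lexx 0).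
(* Since [k] fixes 0, the quotient of [k t] by [t] is within 1 of the derivative at 0 for [t] below
   [d]. *)
have /cvgrPdist_lt/(_ 1 ltr01)/nbhsI[d d0 Hd] := derivI_cvg (k1 (clampI 0)).
set c := derivI _ _ in Hd.
have d'0 : 0 < d^-1 by rewrite invr_gt0.
have dd : d^-1 * d = 1 by rewrite mulVf// gt_eqF.
have n0 : 0 <= `|c| + 1 + d^-1 by rewrite !addr_ge0// ltW.
exists (Num.bound (`|c| + 1 + d^-1)) => t; have := archi_boundP n0.
move: (Num.bound _)%:R => n cn; have cc := ler_norm c; have c0 := normr_ge0 c.
have /andP[tge0 t1] := set_val01 t; have /andP[kge0 kle1] := set_val01 (k t).
(* Away from 0, [k t] is at most 1, hence at most [d^-1 * t]. *)
have [td|td] := ltP (set_val t) d; last nra.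
have [->|tn0] := eqVneq t (clampI 0); first by rewrite Hplus0 t0 mulr0.
have tgt0 : 0 < set_val t.
  rewrite lt_neqAle tge0 andbT eq_sym.
  by apply: contra_neq tn0 => tE; apply: set_val_inj; rewrite tE t0.
have := Hd t; rewrite t0 sub0r normrN ger0_norm// => /(_ td tn0).
rewrite /diff_quot /= Hplus0 t0 !subr0 ltr_norml => /andP[+ _].
rewrite ltrBrDl ltrBlDl -ltrBlDr => kt.
have : set_val (k t) / set_val t <= n by lra.
by rewrite ler_pdivrMr.
Qed.

(** The infinite slope of the square root at 0 makes this map, within [s] of [h], exceed every
    multiple of [x] somewhere near 0. *)
Lemma Hplus_sqrt_perturbation x h (s : R) : 0 < s -> s < 1 ->
  exists f : Hplus R, forall t,
    set_val (f t) = (1 - s) * set_val (h t) + s * Num.sqrt (set_val (x t)).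
Proof.
move=> s0 s1; apply: Hplus_exists.
- have csx : continuous (fun t => Num.sqrt (set_val (x t))).
    exact: (continuous_comp_all (@Hplus_val_continuous R x)
                                (@sqrt_continuous R)).
  exact: (@continuous_linear R _ (1 - s) s _ _ (@Hplus_val_continuous R h) csx).
- move=> t u tu; apply: ltrD; rewrite ltr_pM2l ?subr_gt0//.
    exact: Hplus_lt.
  rewrite ltr_sqrt ?Hplus_lt//.
  have /andP[x0 _] := set_val01 (x t).
  exact: le_lt_trans x0 (Hplus_lt x tu).
- by rewrite !Hplus0 sqrtr0 !mulr0 addr0.
- by rewrite !Hplus1 sqrtr1 !mulr1 subrK.
Qed.

Lemma meager_orbit x : meager (Defs.orbit (shift_action R) x).
Proof.
pose L (n : nat) : set (Hplus R) :=
  [set h | forall t, set_val (h t) <= n%:R * set_val (x t)].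
(* The sets [L n] are cut down to the orbit because [meager] asks for equality with the union. *)
exists (fun n => Defs.orbit (shift_action R) x `&` L n); split.
  move=> n; apply/seteqP; split=> // h.
  move=> /nbhs_ballP[e e0 eL].
  (* [L n] is closed, so a ball inside the closure of the piece lies in [L n]. *)
  have {}eL f : ball h e f -> forall t, set_val (f t) <= n%:R * set_val (x t).
    move=> /eL cf t; apply/ler_addgt0Pr => b b0.
    have [f' [[_ Lf'] /Hplus_ballP/(_ t)]] := cf _ (nbhsx_ballx f b b0).
    by have := Lf' t; rewrite ltr_norml => f'x /andP[_ ff']; lra.
  pose s := Num.min (e / 2) (1 / 2).
  have s0 : 0 < s by rewrite lt_min !divr_gt0.
  have s1 : s < 1 by rewrite gt_min; apply/orP; right; lra.
  have se : s < e by rewrite gt_min gtr_pMr// invf_lt1// ltr1n.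
  have [f fH] := Hplus_sqrt_perturbation x h s0 s1.
  have hf : ball h e f.
    apply: (Hplus_ball se) => t; rewrite fH.
    rewrite (_ : _ - _ = s * (set_val (h t) - Num.sqrt (set_val (x t))));
      last ring.
    rewrite normrM (gtr0_norm s0) ler_piMr ?(ltW s0)//.
    have /andP[h0 h1] := set_val01 (h t); have /andP[x0 x1] := set_val01 (x t).
    have q0 := sqrtr_ge0 (set_val (x t)).
    have q1 : Num.sqrt (set_val (x t)) <= 1
      by have := ler_wsqrtr x1; rewrite sqrtr1.
    by rewrite ler_norml; lra.
  (* At the point where [x] takes the value [v ^+ 2], membership in [L n] would force
     [s * v <= n * v ^+ 2], against [n * v < s]. *)
  pose v : R := s / n.+1%:R.
  have v0 : 0 < v by rewrite divr_gt0.
  have v1 : v <= 1 by rewrite ler_pdivrMr// mul1r (le_trans (ltW s1))// ler1n.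
  have nv : n%:R * v < s.
    rewrite /v mulrA ltr_pdivrMr// mulrC ltr_pM2l// ltr_nat//.
  have := eL f hf (x^-1%g (clampI (v ^+ 2))).
  rewrite fH Hplus_invVK clampI_id; last first.
    by rewrite sqr_ge0 expr_le1// ltW.
  rewrite sqrtr_sqr gtr0_norm//.
  have /andP[h0 _] := set_val01 (h (x^-1%g (clampI (v ^+ 2)))).
  nra.
rewrite -setI_bigcupr; apply/esym/setIidPl => _ [k _ <-].
have [n kn] := Diff_linear_bound k.
by exists n => // t; exact: kn.
Qed.

End Turbulent.

Theorem proposition3p21 (R : realType) : turbulent (shift_action R).
Proof.
split; [exact: meager_orbit|exact: dense_orbit|].
exact: somewhere_dense_local_orbit.
Qed.
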